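(* Let $G$ be a compact topological group, let $X$ and $Y$ be distributive binary $G$-spaces, and let $A\subset X$ be a cross section of the projection $\pi:X\to X|G$. Suppose $f:A\to Y$ is a continuous map such that, for all $a,a',a''\in A$ and $g,h,k,s\in G$, the equality $$g(a,a)=h\big(k(a',a'),s(a'',a'')\big)$$ implies $$g(f(a),f(a))=h\big(k(f(a'),f(a')),s(f(a''),f(a''))\big).$$ Then $f$ has a unique continuous bi-equivariant extension $\widetilde{f}:X\to Y$.
   Context: Binary $G$-space: for a topological group $G$ with identity $e$ and a topological space $X$, a binary action of $G$ on $X$ is a continuous map $\alpha:G\times X^2\to X$, written $\alpha(g,x_1,x_2)=g(x_1,x_2)$, such that $gh(x_1,x_2)=g(x_1,h(x_1,x_2))$ and $e(x_1,x_2)=x_2$ for all $g,h\in G$ and $x_1,x_2\in X$. A topological space with a binary action of $G$ is called a binary $G$-space. It is distributive if $g(h(x,x_1),h(x,x_2))=h(x,g(x_1,x_2))$ for all $x,x_1,x_2\in X$ and $g,h\in G$. Bi-equivariant map: a continuous map $f:X\to Y$ between binary $G$-spaces with $f(g(x_1,x_2))=g(f(x_1),f(x_2))$ for all $g\in G$, $x_1,x_2\in X$. Orbits: a subset $B\subset X$ is bi-invariant if $\{g(b,b'): g\in G,\ b,b'\in B\}=B$. The orbit $[x]$ of $x\in X$ is the minimal bi-invariant subset containing $x$. In a distributive binary $G$-space, $[x]=G(x,x)=\{g(x,x): g\in G\}$ and the orbits partition $X$; $X|G$ denotes the set of orbits with the quotient topology and $\pi:X\to X|G$ the projection. Cross section: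 a continuous map $\sigma:X|G\to X$ with $\pi\sigma=1_{X|G}$. By convention, a closed subset $A\subset X$ that is the image of some such $\sigma$ is also called a cross section (or section) of $\pi$. *)

(* Defs.v *)
From HB Require Import structures.
From mathcomp Require Import all_boot all_order all_algebra.
From mathcomp Require Import all_classical all_reals all_analysis.

Set Implicit Arguments.
Unset Strict Implicit.
Unset Printing Implicit Defensive.

Local Open Scope classical_set_scope.
Local Open Scope quotient_scope.

(* The library only has additive (commutative) topological groups. As usual
   for [topologicalType], no separation axiom is imposed. *)
HB.mixin Record Group_isTopological G of Group G & Topological G := {
  mulg_continuous : continuous (fun p : G * G => (p.1 * p.2)%g);
  invg_continuous : continuous (fun g : G => (g^-1)%g)
}.

#[short(type="topologicalGroupType")]
HB.structure Definition TopologicalGroup :=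
  {G of Group G & Topological G & Group_isTopological G}.

(* [bact g x1 x2] is the element written g(x1, x2). *)
HB.mixin Record Topological_isBinarySpace (G : topologicalGroupType) X
    of Topological X := {
  bact : G -> X -> X -> X;
  bact_continuous :
    continuous (fun p : G * (X * X) => bact p.1 p.2.1 p.2.2);
  bactM : forall (g h : G) (x1 x2 : X),
    bact (g * h)%g x1 x2 = bact g x1 (bact h x1 x2);
  bact1 : forall x1 x2 : X, bact 1%g x1 x2 = x2
}.

#[short(type="binarySpaceType")]
HB.structure Definition BinarySpace (G : topologicalGroupType) :=
  {X of Topological X & Topological_isBinarySpace G X}.

Section BinarySpaces.
Context {G : topologicalGroupType}.
Implicit Types X Y : binarySpaceType G.

Definition distributive_space X :=
  forall (x x1 x2 : X) (g h : G),
    bact g (bact h x x1) (bact h x x2) = bact h x (bact g x1 x2).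

Definition bi_equivariant X Y (f : X -> Y) :=
  continuous f /\
  forall (g : G) (x1 x2 : X), f (bact g x1 x2) = bact g (f x1) (f x2).

Definition bi_invariant X (B : set X) :=
  [set x | exists (g : G) (b b' : X), [/\ B b, B b' & x = bact g b b']] = B.

Definition bi_orbit X (x : X) : set X := smallest (@bi_invariant X) [set x].

Lemma bi_orbit_refl X (x : X) : bi_orbit x x.
Proof. by apply: sub_gen_smallest. Qed.

(* A bi-invariant set is just one that is stable under the action, so the
   intersection defining [bi_orbit x] is itself bi-invariant. *)
Lemma bi_orbit_bi_invariant X (x : X) : bi_invariant (bi_orbit x).
Proof.
apply/seteqP; split => [_ [g [b [b' [Ob Ob' ->]]]] | y Oy]; last first.
  by exists 1%g, y, y; rewrite bact1.
move=> B [BB xB]; rewrite -BB; exists g, b, b'.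
by split=> //; [apply: Ob | apply: Ob'].
Qed.

Definition orbits X := {O : set X | O \in range (@bi_orbit X)}.

Definition to_orbits X (x : X) : orbits X :=
  exist _ (bi_orbit x) (mem_set (imageT (@bi_orbit X) x)).

Lemma orbits_ex X (O : orbits X) : exists x, bi_orbit x = sval O.
Proof. by case: O => O /= /set_mem[x _ <-]; exists x. Qed.

Definition repr_orbits X (O : orbits X) : X := sval (cid (orbits_ex O)).

Lemma repr_orbitsK X : cancel (@repr_orbits X) (@to_orbits X).
Proof.
move=> O; apply/val_inj => /=.
by rewrite /repr_orbits; case: cid.
Qed.

HB.instance Definition _ X := isQuotient.Build X (orbits X) (@repr_orbitsK X).

Definition orbit_space X : topologicalType := quotient_topology (orbits X).

Definition orbit_proj X : X -> orbit_space X :=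
  \pi_(quotient_topology (orbits X)).

Lemma orbit_projE X (x : X) : orbit_proj x = to_orbits x.
Proof. by rewrite /orbit_proj unlock. Qed.

Definition cross_section X (A : set X) :=
  closed A /\
  exists sigma : orbit_space X -> X,
    [/\ continuous sigma, cancel sigma (@orbit_proj X) & range sigma = A].

End BinarySpaces.

Arguments distributive_space {G} X.

(* Main.v *)
Require Import Defs.
From HB Require Import structures.
From mathcomp Require Import all_boot all_order all_algebra.
From mathcomp Require Import all_classical all_reals all_analysis.

(** Distributivity turns the diagonal maps g |-> g(x, x) into orbit maps:
    [bi_orbit x] is just the set of all g(x, x), and these sets partition X.
    A cross section A then provides a continuous retraction r of X onto A,
    constant on orbits, such that every x can be written x = g(r x, r x)
    ([cross_section_retraction]).  An extension must therefore send x to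
    g(f(r x), f(r x)), which gives uniqueness.  Conversely the compatibility
    hypothesis on f says that this value does not depend on the choice of g
    (case a' = a'', h = k = 1), and then that the resulting map is
    bi-equivariant, because x1, x2 and h(x1, x2) are all of the form g(a, a).

    The remaining point is continuity ([continuous_diagonal_extension]).  The
    group element g with x = g(r x, r x) cannot be chosen continuously in x,
    and this is what compactness of G compensates for: at a point x with
    section point b = r x, it is enough to control, for each g separately, the
    pairs (g', x') near (g, x) that satisfy x' = g'(r x', r x').  If
    x = g(b, b), continuity of f, r and of the action does this.
    Otherwise there are no such pairs at all.  Without any separation axiom
    on X this uses that A is closed: g^-1(b, x) lies in the orbit of b and is
    different from b, hence lies outside A; so does g'^-1(r x', x') for
    (g', x') near (g, x), whereas this element would be r x' if
    x' = g'(r x', r x'). *)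

Set Implicit Arguments.
Unset Strict Implicit.
Unset Printing Implicit Defensive.

Local Open Scope classical_set_scope.

Section BinarySpaceTheory.
Context {G : topologicalGroupType}.
Implicit Types X Y : binarySpaceType G.

Lemma bactK X (g : G) (x y : X) : bact g^-1%g x (bact g x y) = y.
Proof. by rewrite -bactM mulVg bact1. Qed.

Lemma bactVK X (g : G) (x y : X) : bact g x (bact g^-1%g x y) = y.
Proof. by rewrite -bactM mulgV bact1. Qed.

Lemma cvg_bact X (T : Type) (F : set_system T) (FF : Filter F)
    (u : T -> G) (v w : T -> X) (g : G) (x y : X) :
  u t @[t --> F] --> g -> v t @[t --> F] --> x -> w t @[t --> F] --> y ->
  bact (u t) (v t) (w t) @[t --> F] --> bact g x y.
Proof.
move=> ug vx wy.
apply: (@cvg_comp _ _ _ (fun t => (u t, (v t, w t)))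
  (fun p : G * (X * X) => bact p.1 p.2.1 p.2.2) _ (nbhs (g, (x, y)))).
  exact: cvg_pair ug (cvg_pair vx wy).
exact: (@bact_continuous G X (g, (x, y))).
Qed.

(** Since y = k(x, x) gives s(x, x) = k(x, (k^-1 * s)(x, x)), distributivity
    moves the common factor k(x, _) out of h(y, s(x, x)). *)
Lemma bact_diag X (k h s : G) (x : X) : distributive_space X ->
  bact h (bact k x x) (bact s x x) = bact (k * h * k^-1 * s)%g x x.
Proof. by move=> dX; rewrite -{1}(bactVK k x (bact s x x)) dX -!bactM. Qed.

Lemma bi_orbitE X (x : X) : distributive_space X ->
  bi_orbit x = range (fun g : G => bact g x x).
Proof.
move=> dX; apply/seteqP; split; last first.
  move=> _ [g _ <-]; rewrite -(bi_orbit_bi_invariant x).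
  by exists g, x, x; split=> //; exact: bi_orbit_refl.
apply: smallest_sub; last by move=> _ ->; exists 1%g; rewrite ?bact1.
apply/seteqP; split=> [_ [h [_ [_ [[k _ <-] [s _ <-] ->]]]]|y By].
  by rewrite bact_diag//; exists (k * h * k^-1 * s)%g.
by exists 1%g, y, y; rewrite bact1.
Qed.

Lemma bi_orbit_diag X (g : G) (x : X) : distributive_space X ->
  bi_orbit (bact g x x) = bi_orbit x.
Proof.
move=> dX; rewrite !bi_orbitE//; apply/seteqP; split=> _ [h _ <-].
  by rewrite dX -bactM; exists (g * h)%g.
by exists (g^-1 * h)%g => //; rewrite dX -bactM mulgA mulgV mul1g.
Qed.

Lemma orbit_proj_diag X (g : G) (x : X) : distributive_space X ->
  orbit_proj (bact g x x) = orbit_proj x.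
Proof.
move=> dX; rewrite !orbit_projE.
(* [val_inj] needs the subtype structure, which [orbits X] carries but not its
   alias [orbit_space X] *)
have : to_orbits (bact g x x) = to_orbits x :> orbits X by
  apply/val_inj; rewrite /= bi_orbit_diag.
exact.
Qed.

Lemma orbit_proj_eq X (x y : X) : distributive_space X ->
  orbit_proj x = orbit_proj y -> exists g : G, x = bact g y y.
Proof.
move=> dX; rewrite !orbit_projE => /(congr1 (@sval _ _)) /= xy.
have := @bi_orbit_refl G X x; rewrite xy bi_orbitE//; case=> g _ <-.
by exists g.
Qed.

(** Composing the projection with the section eliminates the orbit space: a
    retraction onto A that is constant on orbits carries the same data. *)
Lemma cross_section_retraction X (A : set X) :
  distributive_space X -> cross_section A ->
  exists r : X -> A,
    [/\ continuous r, forall a : A, r (val a) = a,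
        forall (g : G) x, r (bact g x x) = r x &
        forall x, exists g : G, x = bact g (val (r x)) (val (r x))].
Proof.
move=> dX [_ [sigma [sigma_cont sigmaK rsigma]]].
have Asigma O : A (sigma O) by rewrite -rsigma; exists O.
exists (fun x => SigSub (mem_set (Asigma (orbit_proj x)))); split.
- (* the topology of A is initial for the inclusion *)
  apply/continuousP => _ [U oU <-].
  apply: (iffLR (continuousP (sigma \o @orbit_proj G X))) => // x.
  apply: continuous_comp; last exact: sigma_cont.
  exact: pi_continuous.
- move=> a; apply/val_inj => /=.
  have [w _ <-] : range sigma (val a) by rewrite rsigma; exact: set_valP.
  by rewrite sigmaK.
- by move=> g x; apply/val_inj; rewrite /= orbit_proj_diag.
- by move=> x; apply: orbit_proj_eq; rewrite //= sigmaK.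
Qed.

(** Compactness of G makes a condition that holds near (g, x) for each g hold,
    for all g at once, at every x' near x; in particular for a g with
    x' = g(r x', r x'), although such a g does not depend continuously on x'. *)
Lemma continuous_diagonal_extension X Y (A : set X) (r : X -> A) (f : A -> Y)
    (F : X -> Y) :
  compact [set: G] -> closed A ->
  continuous r -> (forall a : A, r (val a) = a) ->
  (forall (g : G) x, r (bact g x x) = r x) ->
  (forall x, exists g : G, x = bact g (val (r x)) (val (r x))) ->
  continuous f ->
  (forall (g : G) (a : A), F (bact g (val a) (val a)) = bact g (f a) (f a)) ->
  continuous F.
Proof.
move=> Gcompact Aclosed r_cont rK r_diag r_orbit f_cont Fdiag x U UFx.
have r_cvg (g : G) : r p.2 @[p --> (g, x)] --> r x.
  exact: (cvg_comp (@snd G X) r cvg_snd (r_cont x)).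
have fr_cvg (g : G) : f (r p.2) @[p --> (g, x)] --> f (r x).
  exact: (cvg_comp _ f (r_cvg g) (f_cont (r x))).
have vr_cvg (g : G) : val (r p.2) @[p --> (g, x)] --> val (r x).
  exact: (cvg_comp _ _ (r_cvg g) (@initial_continuous A X set_val (r x))).
pose P (x' : X) (g : G) := x' = bact g (val (r x')) (val (r x')) ->
  U (bact g (f (r x')) (f (r x'))).
suff: \forall x' \near x, [set: G] `<=` P x'.
  apply: filterS => x' Px' /=; have [g x'E] := r_orbit x'.
  by rewrite x'E Fdiag; apply: Px'.
move/compact_near_coveringP: Gcompact; apply=> g _.
have [xE|xNE] := pselect (x = bact g (val (r x)) (val (r x))).
  have UF : nbhs (bact g (f (r x)) (f (r x))) U.
    by rewrite -Fdiag -xE.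
  have: \forall p \near (g, x), U (bact p.1 (f (r p.2)) (f (r p.2))).
    exact: (cvg_bact _ cvg_fst (fr_cvg g) (fr_cvg g)) UF.
  by apply: filterS => -[g' x'] /= Up _.
have NA : ~ A (bact g^-1%g (val (r x)) x).
  move=> Ac; apply: xNE.
  have [k xE] := r_orbit x.
  (* c lies in A and in the orbit of r x, which meets A only at r x *)
  pose c : A := SigSub (mem_set Ac).
  have cE : c = r x.
    by rewrite -(rK c) /= {2}xE -bactM r_diag rK.
  by rewrite -[X in bact g _ X](congr1 val cE) /= bactVK.
have: \forall p \near (g, x), (~` A) (bact p.1^-1%g (val (r p.2)) p.2).
  apply: (cvg_bact _ _ (vr_cvg g) cvg_snd).
    exact: (cvg_comp (@fst G X) (fun h : G => h^-1%g) cvg_fst (@invg_continuous G g)).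
  by apply: open_nbhs_nbhs; split=> //; exact: closed_openC.
apply: filterS => -[g' x'] /= NA' x'E; case: NA'.
by rewrite {2}x'E bactK; exact: set_valP.
Qed.

End BinarySpaceTheory.

Theorem theorem3 (G : topologicalGroupType) (X Y : binarySpaceType G)
    (A : set X) (f : A -> Y) :
  compact [set: G] ->
  distributive_space X ->
  distributive_space Y ->
  cross_section A ->
  continuous f ->
  (forall (a a' a'' : A) (g h k s : G),
     bact g (val a) (val a) =
       bact h (bact k (val a') (val a')) (bact s (val a'') (val a'')) ->
     bact g (f a) (f a) =
       bact h (bact k (f a') (f a')) (bact s (f a'') (f a''))) ->
  exists! F : X -> Y,
    bi_equivariant F /\ (forall a : A, F (val a) = f a).
Proof.
move=> Gcompact dX _ csA f_cont f_compat.
have [r [r_cont rK r_diag r_orbit]] := cross_section_retraction dX csA.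
(* the case h = k = 1, a' = a'' of the compatibility hypothesis *)
have wd (a a' : A) (g h : G) :
    bact g (val a) (val a) = bact h (val a') (val a') ->
    bact g (f a) (f a) = bact h (f a') (f a').
  move=> e; have := f_compat a a' a' g 1%g 1%g h.
  by rewrite !bact1; apply.
pose F x := let g := sval (cid (r_orbit x)) in bact g (f (r x)) (f (r x)).
have Fdiag (g : G) (a : A) : F (bact g (val a) (val a)) = bact g (f a) (f a).
  by apply: wd; rewrite -(svalP (cid (r_orbit _))).
exists F; split; [split; [split|]|].
- exact: (continuous_diagonal_extension Gcompact csA.1 r_cont).
- move=> h x1 x2; have [k x1E] := r_orbit x1; have [s x2E] := r_orbit x2.
  have [g xE] := r_orbit (bact h x1 x2).
  rewrite [in LHS]xE [in F x1]x1E [in F x2]x2E !Fdiag; apply: f_compat.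
  by rewrite -xE -x1E -x2E.
- by move=> a; rewrite -[val a in LHS](bact1 (val a)) Fdiag bact1.
- move=> F' [[_ F'E] F'f]; apply/funext => x; have [g ->] := r_orbit x.
  by rewrite Fdiag F'E F'f.
Qed.
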